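(* Let $G_{1}$ and $G_{2}$ be two simple connected graphs of orders $m$ and $n$, respectively, let $u\in V(G_{1})$ and $v\in V(G_{2})$, and let $G$ be the graph obtained from $G_1$ and $G_2$ (taken vertex-disjoint) by identifying $u$ with $v$. Then $\lambda_{2}(G)\leq\lambda_{2}(G_{1})$. Moreover, if $f_1$ is a harmonic eigenfunction associated with $\lambda_2(G_1)$ with $f_{1}(u)\neq0$, then $\lambda_{2}(G)<\lambda_{2}(G_{1})$.
   Context: For a simple graph $G$, $A$ is its adjacency matrix, $D$ the diagonal matrix of vertex degrees $d(x)$, $L=D-A$ its Laplacian and $\mathcal{L}(G)=D^{-1/2}LD^{-1/2}$ its normalized Laplacian, with eigenvalues $0=\lambda_1(G)\le\lambda_2(G)\le\cdots\le\lambda_n(G)$. Functions $f:V(G)\to\mathbb{R}$ are viewed as vectors; $e$ is the all-ones vector and $f\perp De$ means $\sum_x d(x)f(x)=0$. With $R(f)=\frac{\sum_{xy\in E(G)}(f(x)-f(y))^2}{\sum_{x}d(x)f(x)^2}$, one has $\lambda_2(G)=\inf_{f\neq0,\,f\perp De}R(f)$; a harmonic eigenfunction associated with $\lambda_2(G)$ is a nonzero $f\perp De$ with $R(f)=\lambda_2(G)$.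
   Formalization: The strict inequality is stated only for n ≥ 2, since for n = 1 the graph G is isomorphic to G₁ and the two eigenvalues are equal; also m ≥ 2 is assumed throughout so that λ₂(G₁) exists. *)

(* Defs.v *)
From HB Require Import structures.
From mathcomp Require Import all_boot all_order all_algebra.
From mathcomp Require Import reals.
From mathcomp Require Import polyrcf.

Set Implicit Arguments.
Unset Strict Implicit.
Unset Printing Implicit Defensive.

Import Order.TTheory GRing.Theory Num.Theory.
Local Open Scope ring_scope.

Structure sgraph := SGraph {
  vertex :> finType;
  edge : rel vertex;
  edge_sym : symmetric edge;
  edge_irr : irreflexive edge }.

Definition connected_graph (G : sgraph) : Prop :=
  (0 < #|G|)%N /\ forall x y : G, connect (@edge G) x y.

Definition degree (G : sgraph) (x : G) : nat := #|[set y : G | edge x y]|.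

Section Coalescence.
Variables (G1 G2 : sgraph) (u : G1) (v : G2).

(* The quotient of the disjoint union by u ~ v: the vertex u represents the
   class {u, v}, every other class is a singleton. *)
Definition glue_vertex : finType := (G1 + {y : G2 | y != v})%type.

Definition glue1 (x : G1) : glue_vertex := inl x.

Definition glue2 (y : G2) : glue_vertex :=
  if insub y is Some y' then inr y' else inl u.

(* The edges are the images of the edges of G1 and of G2. *)
Definition glue_edge : rel glue_vertex := fun a b =>
  [exists x, exists y, [&& edge x y, glue1 x == a & glue1 y == b]]
  || [exists x, exists y, [&& edge x y, glue2 x == a & glue2 y == b]].

Lemma glue2_inj : injective glue2.
Proof.
move=> x y; rewrite /glue2.
case: insubP => [x' _ <-|nx]; case: insubP => [y' _ <-|ny] //.
  by case=> ->.
by move: nx ny; rewrite !negbK => /eqP -> /eqP ->.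
Qed.

Lemma glue_edge_sym : symmetric glue_edge.
Proof.
move=> a b; rewrite /glue_edge; congr (_ || _); apply/existsP/existsP;
  by case=> x /existsP [y /and3P [exy ax byy]]; exists y; apply/existsP;
     exists x; rewrite edge_sym exy ax byy.
Qed.

Lemma glue_edge_irr : irreflexive glue_edge.
Proof.
move=> a; apply/negP => /orP [] /existsP [x /existsP [y]].
- by case/and3P => exy /eqP <- /eqP [yx]; rewrite yx edge_irr in exy.
- by case/and3P => exy /eqP <- /eqP /glue2_inj yx; rewrite yx edge_irr in exy.
Qed.

Definition coalescence : sgraph := SGraph glue_edge_sym glue_edge_irr.

End Coalescence.

Section Spectrum.
Variable R : realType.

(* The real roots of the characteristic polynomial in nondecreasing order,
   repeated according to multiplicity; for a real symmetric matrix these are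
   all its eigenvalues. *)
Definition spectrum n (A : 'M[R]_n) : seq R :=
  sort <=%R (flatten [seq nseq (mup a (char_poly A)) a
                     | a <- rootsR (char_poly A)]).

Variable G : sgraph.

Definition adjacency_mx : 'M[R]_#|G| :=
  \matrix_(i, j) (edge (enum_val i) (enum_val j))%:R.

Definition degree_mx : 'M[R]_#|G| :=
  diag_mx (\row_i (degree (enum_val i))%:R).

Definition laplacian_mx : 'M[R]_#|G| := degree_mx - adjacency_mx.

(* D^(-1/2); an isolated vertex, if any, gets the entry 0^-1 = 0. *)
Definition degree_invsqrt_mx : 'M[R]_#|G| :=
  diag_mx (\row_i (Num.sqrt (degree (enum_val i))%:R)^-1).

Definition normalized_laplacian_mx : 'M[R]_#|G| :=
  degree_invsqrt_mx *m laplacian_mx *m degree_invsqrt_mx.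

(* The eigenvalues are numbered from 1. *)
Definition nl_eigenvalue (k : nat) : R :=
  (spectrum normalized_laplacian_mx)`_k.-1.

(* The sum over ordered pairs of adjacent vertices counts each edge twice. *)
Definition rayleigh (f : {ffun G -> R}) : R :=
  ((\sum_x \sum_(y | edge x y) (f x - f y) ^+ 2) / 2)
  / (\sum_x (degree x)%:R * f x ^+ 2).

Definition perp_De (f : {ffun G -> R}) : Prop :=
  \sum_x (degree x)%:R * f x = 0.

Definition harmonic_eigenfunction2 (f : {ffun G -> R}) : Prop :=
  [/\ f != 0, perp_De f & rayleigh f = nl_eigenvalue 2].

End Spectrum.

Arguments nl_eigenvalue {R} G k.

(* Main.v *)
(** Extend an eigenfunction f of G1 to G by the constant value f(u) on G2 and
    subtract its D-weighted mean. The edge sum is unchanged, while the weighted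
    norm grows by f(u)^2 V1 V2 / (V1 + V2), with Vi the sum of the degrees of
    Gi, so the Rayleigh quotient does not increase, and it decreases strictly
    if f(u) <> 0. The variational characterization of the second eigenvalue is
    obtained by intersecting planes with hyperplanes in an orthonormal
    eigenbasis over R[i]. *)

Require Import Defs.
From mathcomp Require Import all_boot all_order all_algebra.
From mathcomp Require Import reals.
From mathcomp Require Import sesquilinear spectral polyrcf complex ring lra.

Set Implicit Arguments.
Unset Strict Implicit.
Unset Printing Implicit Defensive.

Import Order.TTheory GRing.Theory Num.Theory.
Local Open Scope ring_scope.
Local Open Scope sesquilinear_scope.

(** * The spectrum of a real symmetric matrix *)

Lemma mup_prod_XsubC (F : fieldType) (x : F) (s : seq F) :
  mup x (\prod_(a <- s) ('X - a%:P)) = count_mem x s.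
Proof.
elim: s => [|a s IHs]; first by rewrite big_nil mupNroot // root1.
rewrite big_cons mupM ?polyXsubC_eq0 ?monic_neq0 ?monic_prod_XsubC // IHs /=.
by rewrite -['X - a%:P]expr1 mup_XsubCX; case: (a == x).
Qed.

Lemma count_flatten_nseq (T : eqType) (m : T -> nat) (r : seq T) (x : T) :
  uniq r ->
  count_mem x (flatten [seq nseq (m a) a | a <- r]) = ((x \in r) * m x)%N.
Proof.
elim: r => //= a r IHr /andP[ar /IHr]; rewrite count_cat count_nseq inE => ->.
have [->|xa] := eqVneq x a; first by rewrite /= eqxx (negbTE ar) addn0.
by rewrite /= eq_sym (negbTE xa).
Qed.

(** Both sides are sorted, so it suffices that each value occurs equally often before sorting.
    [rootsR] lists every root once, hence a root occurs as often as its multiplicity in the product,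
    which is its count in [s]. *)
Lemma spectrum_prod (R : realType) n (A : 'M[R]_n) (s : seq R) :
  char_poly A = \prod_(a <- s) ('X - a%:P) -> spectrum A = sort <=%R s.
Proof.
move=> As; rewrite /spectrum; apply/perm_sortP;
  [exact: le_total | exact: le_trans | exact: le_anti |].
have p0 : char_poly A != 0 by rewrite monic_neq0 // char_poly_monic.
apply/allP => x _; apply/eqP; rewrite count_flatten_nseq ?uniq_roots //.
rewrite As mup_prod_XsubC -roots_on_rootsR -?As //= As root_prod_XsubC.
by have [_|/count_memPn ->] := boolP (x \in s); rewrite ?mul1n ?muln0.
Qed.

(** Sorting the indices rather than the values keeps [i0] and [i1] distinct even when the two
    smallest values coincide, so they select two independent eigenvectors later. *)
Lemma sort_second (R : realDomainType) n (e : 'I_n -> R) : (2 <= n)%N ->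
  exists i0 i1 : 'I_n, [/\ i0 != i1, e i0 <= e i1,
    (forall i, i != i0 -> e i1 <= e i) &
    (sort <=%R [seq e i | i <- enum 'I_n])`_1 = e i1].
Proof.
move=> n2; rewrite sort_map; set le_e := relpre e _; set s := sort _ _.
have s_sorted : sorted le_e s by apply: sort_sorted => i j; apply: le_total.
have s_uniq : uniq s by rewrite sort_uniq enum_uniq.
have s_all i : i \in s by rewrite mem_sort mem_enum.
have : size s = n by rewrite size_sort size_enum_ord.
case: s s_sorted s_uniq s_all => [|i0 [|i1 s]] //=;
  try by move=> _ _ _ sn; rewrite -sn in n2.
move=> /andP[i01 ps] /andP[i0N _] s_all _; exists i0, i1; split => //.
  by apply: contraNneq i0N => ->; rewrite inE eqxx.
move=> i ii0; have := s_all i; rewrite !inE (negbTE ii0) /=.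
case/predU1P => [->//|si]; have le_e_trans : transitive le_e.
  by move=> j i' k; apply: le_trans.
exact: (allP (order_path_min le_e_trans ps) i si).
Qed.

Lemma mulmx_trC (C : numClosedFieldType) n (g : 'rV[C]_n) :
  (g *m g^t*) 0 0 = \sum_i `|g 0 i| ^+ 2.
Proof. by rewrite mxE; apply: eq_bigr => i _; rewrite !mxE normCK. Qed.

(** * Norm, quadratic form and characteristic polynomial in a unitary eigenbasis *)

Section SpectralForm.
Variables (C : numClosedFieldType) (n : nat) (A : 'M[C]_n).
Hypothesis A_normal : A \is normalmx.

(** Parseval's identity: the rows of [spectralmx A] form an orthonormal basis, in which [g] has the
    coordinates [g *m (spectralmx A)^t*]. *)
Lemma norm_spectral (g : 'rV[C]_n) :
  (g *m g^t*) 0 0 = \sum_i `|(g *m (spectralmx A)^t*) 0 i| ^+ 2.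
Proof.
rewrite -mulmx_trC trmx_mul map_mxM trmxCK mulmxA mulmxKtV //.
exact: spectral_unitarymx.
Qed.

Lemma form_spectral (g : 'rV[C]_n) :
  (g *m A *m g^t*) 0 0 =
  \sum_i spectral_diag A 0 i * `|(g *m (spectralmx A)^t*) 0 i| ^+ 2.
Proof.
rewrite {1}(orthomx_spectralP A_normal) invmx_unitary ?spectral_unitarymx //.
set P := spectralmx A; set c := g *m P^t*.
have -> : g *m (P^t* *m diag_mx (spectral_diag A) *m P) *m g^t*
    = c *m diag_mx (spectral_diag A) *m c^t*.
  by rewrite /c trmx_mul map_mxM trmxCK !mulmxA.
rewrite mul_mx_diag mxE; apply: eq_bigr => i _; rewrite !mxE normCK.
by rewrite mulrAC mulrC.
Qed.

Lemma char_poly_spectral :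
  char_poly A = \prod_i ('X - (spectral_diag A 0 i)%:P).
Proof.
have -> : char_poly A = char_poly (diag_mx (spectral_diag A)).
  rewrite {1}(orthomx_spectralP A_normal).
  have Pu := spectral_unit A; set P := spectralmx A in Pu *.
  set D := diag_mx _; rewrite /char_poly /char_poly_mx.
  have PP : map_mx polyC (invmx P) *m map_mx polyC P = 1%:M.
    by rewrite -map_mxM mulVmx // map_mx1.
  have -> : 'X%:M - map_mx polyC (invmx P *m D *m P) =
    map_mx polyC (invmx P) *m ('X%:M - map_mx polyC D) *m map_mx polyC P.
    rewrite mulmxBr mulmxBl !map_mxM; congr (_ - _).
    by rewrite -mulmxA mul_scalar_mx -scalemxAr PP scalemx1.
  by rewrite !det_mulmx mulrAC -det_mulmx PP det1 mul1r.
rewrite char_poly_trig ?diag_mx_is_trig //.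
by apply: eq_bigr => i _; rewrite mxE eqxx mulr1n.
Qed.

End SpectralForm.

Lemma dotvE (R : pzRingType) n (x : 'rV[R]_n) : (x *m x^T) 0 0 = \sum_i x 0 i ^+ 2.
Proof. by rewrite mxE; apply: eq_bigr => i _; rewrite mxE. Qed.

Lemma dotv_ge0 (R : realDomainType) n (x : 'rV[R]_n) : 0 <= (x *m x^T) 0 0.
Proof. by rewrite dotvE sumr_ge0 // => i _; rewrite sqr_ge0. Qed.

Lemma dotv_gt0 (R : realDomainType) n (x : 'rV[R]_n) :
  x != 0 -> 0 < (x *m x^T) 0 0.
Proof.
move=> x0; rewrite lt_neqAle dotv_ge0 andbT eq_sym; apply: contraNneq x0.
rewrite dotvE => /eqP; rewrite psumr_eq0 => [/allP z|i _]; last exact: sqr_ge0.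
apply/eqP/rowP => i; have /eqP := z i (mem_index_enum i).
by rewrite mxE => /eqP; rewrite sqrf_eq0 => /eqP.
Qed.

(** * Variational bounds for the second eigenvalue of a real symmetric matrix *)

Section RealSymmetric.
Variables (R : realType) (n : nat) (A : 'M[R]_n).
Hypotheses (A_sym : A^T = A) (n2 : (2 <= n)%N).

Local Notation toC := (map_mx (real_complex R)).

Lemma toC_trC (m p : nat) (B : 'M[R]_(m, p)) : (toC B)^t* = toC B^T.
Proof. by apply/matrixP => i j; rewrite !mxE; exact: conjc_real. Qed.

Lemma toC_real (m p : nat) (B : 'M[R]_(m, p)) : toC B \is a mxOver Num.real.
Proof. by apply/mxOverP => i j; rewrite mxE complex_real. Qed.

Lemma toC_sym : toC A \is symmetricmx.
Proof.
by apply/is_hermitianmxP; rewrite expr0 scale1r map_mx_id // map_trmx A_sym.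
Qed.

Lemma toC_normal : toC A \is normalmx.
Proof. by rewrite symmetric_normalmx ?toC_sym ?toC_real. Qed.

Let P := spectralmx (toC A).
Let ev (i : 'I_n) : R := complex.Re (spectral_diag (toC A) 0 i).

(** A real symmetric matrix is Hermitian over [R[i]], so its eigenvalues are real and taking real
    parts in [ev] loses nothing. *)
Lemma spectral_diag_toC i : spectral_diag (toC A) 0 i = (ev i)%:C%C.
Proof.
rewrite /ev RRe_real //; apply/mxOverP/hermitian_spectral_diag_real.
by rewrite realsym_hermsym ?toC_sym ?toC_real.
Qed.

(** The characteristic polynomial splits over [R[i]] with real roots; the embedding of polynomials
    is injective, so the factorization descends to [R]. *)
Lemma spectrum_sym : spectrum A = sort <=%R [seq ev i | i <- enum 'I_n].
Proof.
apply: spectrum_prod; rewrite big_map big_enum /=.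
apply: (map_poly_inj (real_complex R)); rewrite map_char_poly.
rewrite char_poly_spectral ?toC_normal // rmorph_prod.
by apply: eq_bigr => i _; rewrite /= map_polyXsubC spectral_diag_toC.
Qed.

(** Lower half of the variational principle. On vectors orthogonal to the first eigenvector the form
    is at least the second eigenvalue times the squared norm. The plane of [w] and [y] contains such
    a nonzero vector, and [A] only sees its [y] component because [w] lies in the kernel. *)
Lemma second_eigenvalue_le (w y : 'rV[R]_n) :
  w *m A = 0 -> w != 0 -> w *m y^T = 0 -> 0 <= (y *m A *m y^T) 0 0 ->
  (spectrum A)`_1 * (y *m y^T) 0 0 <= (y *m A *m y^T) 0 0.
Proof.
move=> wA w0 wy Ay; rewrite spectrum_sym.
have [i0 [i1 [_ _ e_ge ->]]] := sort_second ev n2.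
set l := ev i1; set q := (y *m A *m y^T) 0 0 in Ay *.
pose c (g : 'rV[R[i]]_n) := (g *m P^t*) 0 i0.
(* Some nonzero combination of w and y is orthogonal to the eigenvector of the
   smallest eigenvalue. *)
have [a [b [ab cab]]] : exists a b : R[i],
    (a, b) != 0 /\ c (a *: toC w + b *: toC y) = 0.
  have cD a b : c (a *: toC w + b *: toC y) = a * c (toC w) + b * c (toC y).
    by rewrite /c mulmxDl -!scalemxAl !mxE.
  have [yw0|yw0] := eqVneq (c (toC y), c (toC w)) 0.
    exists 0, 1; split; first by rewrite xpair_eqE oner_eq0 andbF.
    by case: yw0 => cy _; rewrite cD cy mul0r mulr0 addr0.
  exists (c (toC y)), (- c (toC w)); split; last by rewrite cD mulNr mulrC subrr.
  by move: yw0; rewrite !xpair_eqE oppr_eq0.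
set g := _ + _ in cab.
have yA : A *m w^T = 0 by rewrite -A_sym -trmx_mul wA trmx0.
have yw : y *m w^T = 0 by rewrite -[y]trmxK -trmx_mul wy trmx0.
have gt : g^t* = a^* *: toC w^T + b^* *: toC y^T.
  by rewrite /g linearD !linearZ /= map_mxD !map_mxZ !toC_trC.
have gAg : (g *m toC A *m g^t*) 0 0 = `|b| ^+ 2 * q%:C%C.
  have -> : g *m toC A = b *: toC (y *m A).
    by rewrite /g mulmxDl -!scalemxAl -!map_mxM wA map_mx0 scaler0 add0r.
  rewrite gt mulmxDr -!scalemxAl -!scalemxAr -!map_mxM -[y *m A *m w^T]mulmxA.
  by rewrite yA mulmx0 map_mx0 !scaler0 add0r scalerA normCK mxE mxE.
have gg : (g *m g^t*) 0 0 =
    `|a| ^+ 2 * ((w *m w^T) 0 0)%:C%C + `|b| ^+ 2 * ((y *m y^T) 0 0)%:C%C.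
  rewrite gt /g mulmxDl !mulmxDr -!scalemxAl -!scalemxAr -!map_mxM wy yw.
  rewrite map_mx0 !scaler0 addr0 add0r !scalerA !normCK mxE.
  by congr (_ + _); rewrite mxE mxE.
have : l%:C%C * (g *m g^t*) 0 0 <= (g *m toC A *m g^t*) 0 0.
  rewrite form_spectral ?toC_normal // (norm_spectral (toC A)) mulr_sumr.
  apply: ler_sum => i _; rewrite spectral_diag_toC.
  have [->|ii0] := eqVneq i i0; first by rewrite [X in `|X|]cab normr0 expr0n !mulr0.
  by rewrite ler_wpM2r ?exprn_ge0 // lecR e_ge.
rewrite gAg gg.
rewrite !normc_def -!rmorphXn -!rmorphM -rmorphD -rmorphM lecR /=.
set ra := Num.sqrt _; set rb := Num.sqrt _; set W := (w *m w^T) 0 0.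
set Y := (y *m y^T) 0 0 => H.
have W0 : 0 < W by exact: dotv_gt0.
have Y0 : 0 <= Y by exact: dotv_ge0.
have [rb0|rb0] := eqVneq rb 0; last first.
  have {}rb0 : 0 < rb ^+ 2 by rewrite exprn_even_gt0.
  have [l0|l0] := leP 0 l; last by rewrite (le_trans _ Ay) // mulr_le0_ge0 // ltW.
  rewrite -(ler_pM2l rb0); apply: le_trans H; rewrite mulrCA ler_wpM2l //.
  by rewrite lerDr mulr_ge0 ?sqr_ge0 // ltW.
have ra0 : 0 < ra ^+ 2.
  rewrite exprn_even_gt0 //=; apply: contraNneq ab => ra0.
  have norm0 (z : R[i]) :
      Num.sqrt (complex.Re z ^+ 2 + complex.Im z ^+ 2) = 0 -> z = 0.
    by move=> z0; apply/eqP; rewrite -normr_eq0 normc_def z0.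
  by rewrite (norm0 a) // (norm0 b).
move: H; rewrite rb0 expr0n !mul0r addr0 mulrA pmulr_lle0 // pmulr_lle0 // => l0.
by rewrite (le_trans _ Ay) // mulr_le0_ge0.
Qed.

(** Upper half of the variational principle: on the span of the first two eigenvectors the form is
    at most the second eigenvalue times the squared norm, and this plane meets every hyperplane in a
    nonzero vector. *)
Lemma second_eigenvalue_attained (w : 'rV[R]_n) :
  exists x : 'rV[R]_n, [/\ x != 0, w *m x^T = 0 &
    (x *m A *m x^T) 0 0 <= (spectrum A)`_1 * (x *m x^T) 0 0].
Proof.
rewrite spectrum_sym.
have [i0 [i1 [i01 e_le _ ->]]] := sort_second ev n2; set l := ev i1 in e_le *.
(* Some nonzero combination of the first two eigenvectors is orthogonal to w;
   its real or its imaginary part is the required vector. *)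
pose s i := (row i P *m toC w^T) 0 0.
have [a [b [ab sab]]] : exists a b : R[i], (a, b) != 0 /\ a * s i0 + b * s i1 = 0.
  have [s0|s0] := eqVneq (s i1, s i0) 0.
    exists 0, 1; split; first by rewrite xpair_eqE oner_eq0 andbF.
    by case: s0 => s0 _; rewrite s0 mul0r mulr0 addr0.
  exists (s i1), (- s i0); split; last by rewrite mulNr mulrC subrr.
  by move: s0; rewrite !xpair_eqE oppr_eq0.
have PP : P *m P^t* = 1%:M by apply/unitarymxP/spectral_unitarymx.
pose c : 'rV[R[i]]_n := a *: delta_mx 0 i0 + b *: delta_mx 0 i1.
pose g := c *m P.
have gP : g *m P^t* = c by rewrite /g -mulmxA PP mulmx1.
have gw : g *m toC w^T = 0.
  rewrite /g /c mulmxDl mulmxDl -!scalemxAl -!rowE.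
  apply/matrixP => i j; rewrite !ord1 mxE.
  by rewrite mxE [in X in _ + X]mxE -/(s i0) -/(s i1) sab mxE.
have g0 : g != 0.
  apply: contraNneq ab => g0; move: gP; rewrite g0 mul0mx => /esym c0.
  have := congr1 (fun M : 'rV__ => M 0 i0) c0.
  have := congr1 (fun M : 'rV__ => M 0 i1) c0.
  rewrite /c !mxE !eqxx (negbTE i01) eq_sym (negbTE i01) /= !mulr0 !mulr1.
  by rewrite add0r addr0 => -> ->.
have gAg : (g *m toC A *m g^t*) 0 0 <= l%:C%C * (g *m g^t*) 0 0.
  rewrite form_spectral ?toC_normal // (norm_spectral (toC A)) mulr_sumr.
  apply: ler_sum => i _; rewrite spectral_diag_toC gP.
  have [->|ii0] := eqVneq i i0; first by rewrite ler_wpM2r ?exprn_ge0 // lecR.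
  have [->//|ii1] := eqVneq i i1.
  by rewrite /c !mxE (negbTE ii0) (negbTE ii1) !mulr0 addr0 normr0 expr0n !mulr0.
clearbody g.
pose x := map_mx (@complex.Re R) g; pose y := map_mx (@complex.Im R) g.
have gxy : g = toC x + 'i%C *: toC y.
  by apply/matrixP => i j; rewrite !mxE -complexE.
have gt : g^t* = toC x^T - 'i%C *: toC y^T.
  apply/matrixP => i j; rewrite !mxE; apply/eqP; rewrite eq_complex.
  by case: (g j i) => p q /=;
    rewrite !(mul0r, mul1r, subr0, subrr, add0r, addr0, oppr0, eqxx).
(* For symmetric real [B] the cross terms between the real part [x] and the imaginary part [y]
   cancel. Taking [B] to be [A] and the identity turns the complex inequality into a sum of two real
   ones. *)
have form (B : 'M[R]_n) : B^T = B ->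
    (g *m toC B *m g^t*) 0 0 = ((x *m B *m x^T) 0 0 + (y *m B *m y^T) 0 0)%:C%C.
  move=> BT; rewrite gt gxy !mulmxDl !mulmxDr !mulmxN -!scalemxAl -!scalemxAr.
  rewrite -!map_mxM scalerA -expr2 sqr_i scaleN1r opprK.
  have -> : y *m B *m x^T = x *m B *m y^T.
    apply/matrixP => i j; rewrite !ord1 -[in RHS]BT -[x in RHS]trmxK -!trmx_mul.
    by rewrite [in RHS]mxE mulmxA.
  rewrite addrA subrK.
  by rewrite !mxE rmorphD.
have gg := form 1%:M (trmx1 _ _); rewrite map_mx1 !mulmx1 in gg.
move: gAg; rewrite form // gg -rmorphM lecR mulrDr => Hxy.
have xw : toC (x *m w^T) = 0 /\ toC (y *m w^T) = 0.
  move: gw; rewrite gxy mulmxDl -scalemxAl -!map_mxM => /matrixP gw.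
  by split; apply/matrixP => i j; have := gw i j; rewrite !mxE;
    case=> /=; rewrite !mul0r !mul1r ?subr0 ?addr0 ?add0r => Re0 Im0; apply/eqP;
    rewrite eq_complex /= ?Re0 ?Im0 !eqxx.
have perp (z : 'rV[R]_n) : toC (z *m w^T) = 0 -> w *m z^T = 0.
  move=> zw; rewrite -[w]trmxK -trmx_mul; apply: (@map_mx_inj _ _ (real_complex R)).
  by rewrite -map_trmx zw trmx0 map_mx0.
have [x0|x0] := eqVneq x 0.
  exists y; split; [|exact: perp xw.2|].
    by apply: contraNneq g0 => y0; rewrite gxy x0 y0 !map_mx0 scaler0 addr0.
  by move: Hxy; rewrite x0 !mul0mx !mxE mulr0 !add0r.
(* If [x] violates its inequality, the summed inequality [Hxy] forces the one for [y]; moreover [y]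
   is nonzero, since otherwise [Hxy] would be the inequality for [x]. *)
have [Hx|Hx] := leP ((x *m A *m x^T) 0 0) (l * (x *m x^T) 0 0).
  by exists x; split => //; exact: perp xw.1.
exists y; split; last 2 first.
- exact: perp xw.2.
- by rewrite -(lerD2l (l * (x *m x^T) 0 0)) (le_trans _ Hxy) // lerD2r ltW.
apply: contraTneq Hx => y0; rewrite -leNgt.
by move: Hxy; rewrite y0 !mul0mx !mxE mulr0 !addr0.
Qed.

End RealSymmetric.

(** * The quadratic form of the normalized Laplacian *)

Section Graph.
Variables (R : realType) (G : sgraph).
Implicit Types (f g h : G -> R) (x y : G).

(* Sums over ordered pairs of adjacent vertices, so each edge counts twice. *)
Definition edge_sum (T : nmodType) (F : G -> G -> T) : T :=
  \sum_x \sum_(y | edge x y) F x y.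

Lemma sum_degree h :
  \sum_x (degree x)%:R * h x = edge_sum (fun x _ => h x).
Proof.
apply: eq_bigr => x _; rewrite sumr_const mulr_natl.
by congr (_ *+ _); rewrite /degree cardsE.
Qed.

Lemma edge_sum_swap (T : nmodType) (F : G -> G -> T) :
  edge_sum F = edge_sum (fun x y => F y x).
Proof.
rewrite /edge_sum (exchange_big_dep predT) //=; apply: eq_bigr => y _.
by apply: eq_bigl => x; rewrite edge_sym.
Qed.

Lemma degree_neq0 x y : edge x y -> degree x != 0%N.
Proof. by move=> xy; rewrite -lt0n; apply/card_gt0P; exists y; rewrite inE. Qed.

Definition vrow h : 'rV[R]_#|G| := \row_i h (enum_val i).

Lemma sum_enum_val (T : nmodType) (F : G -> T) :
  \sum_(i < #|G|) F (enum_val i) = \sum_x F x.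
Proof.
by rewrite [RHS](reindex (@enum_val G G)) //=; exact/onW_bij/enum_val_bij.
Qed.

Lemma laplacian_row h :
  vrow h *m laplacian_mx R G = vrow (fun x => \sum_(y | edge x y) (h x - h y)).
Proof.
apply/rowP => j; rewrite mulmxBr mul_mx_diag !mxE; set x := enum_val j.
have -> : \sum_(y | edge x y) (h x - h y) =
    h x * (degree x)%:R - \sum_(y | edge x y) h y.
  by rewrite sumrB sumr_const mulr_natr /degree cardsE.
congr (_ - _).
under eq_bigr do rewrite !mxE.
rewrite (sum_enum_val (fun y => h y * (edge y x)%:R)) [RHS]big_mkcond.
by apply: eq_bigr => y _; rewrite edge_sym; case: (edge x y); rewrite ?mulr1 ?mulr0.
Qed.

Lemma laplacian_form h : (vrow h *m laplacian_mx R G *m (vrow h)^T) 0 0 =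
  edge_sum (fun x y => (h x - h y) ^+ 2) / 2.
Proof.
rewrite laplacian_row mxE; under eq_bigr do rewrite !mxE.
rewrite (sum_enum_val (fun x => (\sum_(y | edge x y) (h x - h y)) * h x)).
set S := LHS.
have S1 : S = edge_sum (fun x y => (h x - h y) * h x).
  (* Exchanging the two ends of each ordered edge gives a second expression [S2] for the same sum;
     adding the two produces the squares. *)
  by apply: eq_bigr => x _; rewrite mulr_suml.
have S2 : S = edge_sum (fun x y => (h y - h x) * h y) by rewrite S1 edge_sum_swap.
have : S + S = edge_sum (fun x y => (h x - h y) ^+ 2).
  rewrite {1}S1 S2 /edge_sum -big_split; apply: eq_bigr => x _.
  by rewrite -big_split; apply: eq_bigr => y _ /=; ring.
by move=> <-; field.
Qed.

(* The vector D^(1/2) f. *)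
Definition weighted f : 'rV[R]_#|G| := vrow (fun x => Num.sqrt (degree x)%:R * f x).

(* D^(-1/2) D^(1/2) f, which vanishes at isolated vertices. *)
Let rescaled f : G -> R := fun x => (degree x != 0%N)%:R * f x.

Lemma weighted_rescale f :
  weighted f *m degree_invsqrt_mx R G = vrow (rescaled f).
Proof.
apply/rowP => i; rewrite mul_mx_diag !mxE /rescaled; set d := degree _.
rewrite mulrAC; congr (_ * _); have [->|d0] := eqVneq d 0%N.
  by rewrite sqrtr0 mul0r.
by rewrite divff // gt_eqF // sqrtr_gt0 ltr0n lt0n.
Qed.

Lemma rescaled_edge f x y : edge x y -> rescaled f x = f x.
Proof. by move=> /degree_neq0 d0; rewrite /rescaled d0 mul1r. Qed.

Lemma invsqrt_tr : (degree_invsqrt_mx R G)^T = degree_invsqrt_mx R G.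
Proof. exact: tr_diag_mx. Qed.

Lemma nl_sym : (normalized_laplacian_mx R G)^T = normalized_laplacian_mx R G.
Proof.
rewrite !trmx_mul invsqrt_tr mulmxA; congr (_ *m _ *m _).
rewrite linearB /= tr_diag_mx; congr (_ - _).
by apply/matrixP => i j; rewrite !mxE edge_sym.
Qed.

(** The substitution [D^(1/2) f] turns the normalized form into the Laplacian form. The values lost
    at isolated vertices do not matter, since no edge meets them. *)
Lemma nl_form f :
  (weighted f *m normalized_laplacian_mx R G *m (weighted f)^T) 0 0 =
  edge_sum (fun x y => (f x - f y) ^+ 2) / 2.
Proof.
rewrite /normalized_laplacian_mx !mulmxA weighted_rescale.
rewrite -[_ *m _ *m (weighted f)^T]mulmxA.
have -> : degree_invsqrt_mx R G *m (weighted f)^T = (vrow (rescaled f))^T.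
  by rewrite -weighted_rescale trmx_mul invsqrt_tr.
rewrite laplacian_form; congr (_ / _); apply: eq_bigr => x _.
apply: eq_bigr => y xy; rewrite (rescaled_edge _ xy).
by rewrite edge_sym in xy; rewrite (rescaled_edge _ xy).
Qed.

Lemma nl_weighted1 : weighted (fun=> 1) *m normalized_laplacian_mx R G = 0.
Proof.
rewrite /normalized_laplacian_mx !mulmxA weighted_rescale laplacian_row.
rewrite [vrow _](_ : _ = 0) ?mul0mx //; apply/rowP => i; rewrite !mxE.
rewrite big1 // => y xy; rewrite (rescaled_edge _ xy).
by rewrite edge_sym in xy; rewrite (rescaled_edge _ xy) subrr.
Qed.

Lemma weighted_dot f g :
  (weighted f *m (weighted g)^T) 0 0 = \sum_x (degree x)%:R * (f x * g x).
Proof.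
rewrite mxE -sum_enum_val; apply: eq_bigr => i _; rewrite !mxE mulrACA -expr2.
by rewrite sqr_sqrtr.
Qed.

(** The kernel vector is [D^(1/2) e], nonzero because the volume is positive; orthogonality of
    [D^(1/2) f] to it is exactly [f] being orthogonal to [De]. *)
Lemma nl_eigenvalue2_le f : (2 <= #|G|)%N -> 0 < \sum_(x : G) (degree x)%:R :> R ->
  \sum_x (degree x)%:R * f x = 0 ->
  nl_eigenvalue G 2 * \sum_x (degree x)%:R * f x ^+ 2 <=
  edge_sum (fun x y => (f x - f y) ^+ 2) / 2.
Proof.
move=> G2 vol fperp; rewrite -nl_form -[\sum_x _](weighted_dot f f).
apply: (second_eigenvalue_le nl_sym G2 nl_weighted1).
- apply: contraTneq vol => w0; rewrite -leNgt.
  rewrite (eq_bigr (fun x => (degree x)%:R * (1 * 1))) => [|x _]; last first.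
    by rewrite !mulr1.
  by rewrite -(weighted_dot (fun=> 1)) w0 mul0mx mxE.
- apply/matrixP => i j; rewrite !ord1 weighted_dot mxE -[RHS]fperp.
  by apply: eq_bigr => x _; rewrite mul1r.
- rewrite nl_form divr_ge0 // sumr_ge0 // => x _.
  by rewrite sumr_ge0 // => y _; rewrite sqr_ge0.
Qed.

Lemma nl_eigenvalue2_attained : (2 <= #|G|)%N -> (forall x, degree x != 0%N) ->
  exists f, [/\ 0 < \sum_x (degree x)%:R * f x ^+ 2,
    \sum_x (degree x)%:R * f x = 0 &
    edge_sum (fun x y => (f x - f y) ^+ 2) / 2 <=
    nl_eigenvalue G 2 * \sum_x (degree x)%:R * f x ^+ 2].
Proof.
move=> G2 deg; have [z [z0 zw zA]] :=
  second_eigenvalue_attained nl_sym G2 (weighted (fun=> 1)).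
(* Undoes the substitution [z = D^(1/2) f], which is possible as all degrees are positive. *)
pose f x := z 0 (enum_rank x) / Num.sqrt (degree x)%:R.
have zf : z = weighted f.
  apply/rowP => i; rewrite !mxE /f enum_valK mulrC divfK //.
  by rewrite gt_eqF // sqrtr_gt0 ltr0n lt0n.
exists f; rewrite -[\sum_x _ * _ ^+ 2](weighted_dot f f) -zf.
split; first exact: dotv_gt0.
  move/matrixP: zw => /(_ 0 0); rewrite zf weighted_dot [RHS]mxE => H.
  rewrite -[RHS]H.
  by apply: eq_bigr => x _; rewrite mul1r.
by rewrite -nl_form -zf.
Qed.

End Graph.

(** * Splitting edge sums over a coalescence *)

Section Glue.
Variables (G1 G2 : sgraph) (u : G1) (v : G2).
Local Notation G := (coalescence u v).
Local Notation g1 := (@glue1 G1 G2 v : G1 -> G).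
Local Notation g2 := (@glue2 G1 G2 u v : G2 -> G).

Lemma glue1_inj : injective g1.
Proof. by move=> x y []. Qed.

Lemma glue12_eq x y : g1 x = g2 y -> x = u /\ y = v.
Proof.
rewrite /glue1 /glue2; case: insubP => [//|]; rewrite negbK => /eqP -> [->].
by [].
Qed.

(** The two copies share only the glued vertex, so an edge coming from both graphs would be a loop
    at [v]. The edge set is therefore the disjoint union of two injective images. *)
Lemma coalescence_edge_sum (T : nmodType) (F : G -> G -> T) :
  edge_sum F = edge_sum (fun x y => F (g1 x) (g1 y)) +
               edge_sum (fun x y => F (g2 x) (g2 y)).
Proof.
rewrite /edge_sum !pair_big_dep.
pose E (H : sgraph) := [set p : H * H | edge p.1 p.2].
pose map2 (H : sgraph) (g : H -> G) (p : H * H) := (g p.1, g p.2).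
have map2_inj (H : sgraph) (g : H -> G) : injective g -> injective (map2 H g).
  by move=> gI [a b] [c d] [/gI -> /gI ->].
have E_glue : E G = map2 _ g1 @: E G1 :|: map2 _ g2 @: E G2.
  apply/setP => -[a b]; rewrite !inE /= /glue_edge; congr (_ || _).
    apply/existsP/imsetP => [[x /existsP[y /and3P[xy /eqP <- /eqP <-]]]|].
      by exists (x, y); rewrite ?inE.
    by case=> -[x y]; rewrite inE => xy [-> ->]; exists x; apply/existsP; exists y;
      rewrite xy !eqxx.
  apply/existsP/imsetP => [[x /existsP[y /and3P[xy /eqP <- /eqP <-]]]|].
    by exists (x, y); rewrite ?inE.
  by case=> -[x y]; rewrite inE => xy [-> ->]; exists x; apply/existsP; exists y;
    rewrite xy !eqxx.
have E_disj : [disjoint map2 _ g1 @: E G1 & map2 _ g2 @: E G2].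
  rewrite disjoints_subset; apply/subsetP => _ /imsetP[[x y] _ ->]; rewrite inE.
  apply/imsetP => -[[x' y']]; rewrite inE /= => xy [].
  move=> /glue12_eq[_ x'v] /glue12_eq[_ y'v].
  by rewrite x'v y'v edge_irr in xy.
have sumE (H : sgraph) (K : H * H -> T) :
    \sum_(p | edge p.1 p.2) K p = \sum_(p in E H) K p.
  by apply: eq_bigl => p; rewrite inE.
rewrite !sumE E_glue; under eq_bigl do rewrite in_setU.
rewrite bigU //= !big_imset //=; apply: in2W; apply: map2_inj.
  exact: glue2_inj.
exact: glue1_inj.
Qed.

End Glue.

(** * Eigenvalues of a coalescence *)

Section Connected.
Variables (R : realType) (G : sgraph).
Hypotheses (conn : connected_graph G).

Lemma connected_degree (x : G) : (2 <= #|G|)%N -> degree x != 0%N.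
Proof.
move=> G2; have /card_gt0P[y] : (0 < #|predC1 x|)%N.
  by rewrite cardC1 -subn1 subn_gt0.
rewrite !inE => yx; have /connectP[[|z p] /=] := conn.2 x y.
  by move=> _ yx'; rewrite yx' eqxx in yx.
by case/andP => xz _ _; exact: degree_neq0 xz.
Qed.

Lemma connected_volume : (2 <= #|G|)%N -> 0 < \sum_(x : G) (degree x)%:R :> R.
Proof.
move=> G2; have /card_gt0P[x0 _] := conn.1.
rewrite (bigD1 x0) //= ltr_wpDr ?sumr_ge0 // ltr0n lt0n.
exact: connected_degree.
Qed.

(** A vanishing sum of squares makes [f] constant across edges, hence along any path from [x] to
    [y]. *)
Lemma connected_edge_sum_gt0 (f : G -> R) (x y : G) : f x != f y ->
  0 < edge_sum (fun x y => (f x - f y) ^+ 2).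
Proof.
have inner_ge0 (z : G) : 0 <= \sum_(t | edge z t) (f z - f t) ^+ 2.
  by rewrite sumr_ge0 // => t _; rewrite sqr_ge0.
move=> fxy; rewrite lt_neqAle [X in _ && X]sumr_ge0 // andbT eq_sym.
apply: contraNneq fxy => /eqP; rewrite psumr_eq0 // => /allP E0.
have f_edge z t : edge z t -> f z = f t.
  move=> zt; have := E0 z (mem_index_enum _); rewrite /= psumr_eq0.
    move/allP/(_ t (mem_index_enum _)); rewrite zt /= sqrf_eq0 subr_eq0.
    by move/eqP.
  by move=> ? _; rewrite sqr_ge0.
have /connectP[p] := conn.2 x y.
elim: p x => [|z p IHp] x /=; first by move=> _ ->.
by case/andP => xz zp yE; rewrite (f_edge _ _ xz) IHp.
Qed.

End Connected.

(** * Comparison of the second eigenvalues of the coalescence and of [G1] *)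

Section Glue.
Variables (R : realType) (G1 G2 : sgraph) (u : G1) (v : G2).
Hypotheses (conn1 : connected_graph G1) (m2 : (2 <= #|G1|)%N).
Local Notation G := (coalescence u v).
Local Notation g1 := (@glue1 G1 G2 v : G1 -> G).
Local Notation g2 := (@glue2 G1 G2 u v : G2 -> G).
Let V1 : R := \sum_(x : G1) (degree x)%:R.
Let V2 : R := \sum_(y : G2) (degree y)%:R.

Lemma coalescence_sum_degree (h : G -> R) :
  \sum_x (degree x)%:R * h x =
  \sum_x (degree x)%:R * h (g1 x) + \sum_y (degree y)%:R * h (g2 y).
Proof. by rewrite !sum_degree coalescence_edge_sum. Qed.

Lemma coalescence_eigenvalue2 (f : G1 -> R) :
  \sum_x (degree x)%:R * f x = 0 ->
  nl_eigenvalue G 2 *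
    (\sum_x (degree x)%:R * f x ^+ 2 + f u ^+ 2 * (V1 * V2 / (V1 + V2))) <=
  edge_sum (fun x y => (f x - f y) ^+ 2) / 2.
Proof.
move=> f_perp.
have V1_gt0 : 0 < V1 by exact: connected_volume.
(* Only a weak inequality is available: [V2] vanishes when [G2] is a single vertex. *)
have V2_ge0 : 0 <= V2 by rewrite sumr_ge0.
have V_neq0 : V1 + V2 != 0 by rewrite gt_eqF // ltr_wpDr.
(* The weighted mean of the extended function: the part on [G1] contributes 0 to the weighted sum by
   [f_perp], and the constant part on [G2] contributes [V2 * f u]. *)
pose c := V2 * f u / (V1 + V2).
pose F (a : G) : R := (if a is inl x then f x else f u) - c.
have F1 x : F (g1 x) = f x - c by [].
have F2 y : F (g2 y) = f u - c by rewrite /F /glue2; case: insub.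
have volG : \sum_(x : G) (degree x)%:R = V1 + V2.
  under eq_bigr do rewrite -[_%:R]mulr1.
  by rewrite (coalescence_sum_degree (fun=> 1)); congr (_ + _);
    apply: eq_bigr => x _; rewrite mulr1.
have sum1 : \sum_x (degree x)%:R * F (g1 x) = - (V1 * c).
  under eq_bigr do rewrite F1 mulrBr.
  by rewrite sumrB f_perp sub0r mulr_suml.
have sum2 : \sum_y (degree y)%:R * F (g2 y) = V2 * (f u - c).
  by under eq_bigr do rewrite F2; rewrite mulr_suml.
have F_perp : \sum_x (degree x)%:R * F x = 0.
  rewrite coalescence_sum_degree sum1 sum2 /c; field.
  by rewrite V_neq0.
have sq1 : \sum_x (degree x)%:R * F (g1 x) ^+ 2 =
    \sum_x (degree x)%:R * f x ^+ 2 + V1 * c ^+ 2.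
  transitivity (\sum_x ((degree x)%:R * f x ^+ 2 - 2 * c * ((degree x)%:R * f x)
                        + (degree x)%:R * c ^+ 2)).
    by apply: eq_bigr => x _; rewrite F1; ring.
  by rewrite big_split sumrB -mulr_sumr f_perp mulr0 subr0 -mulr_suml.
have sq2 : \sum_y (degree y)%:R * F (g2 y) ^+ 2 = V2 * (f u - c) ^+ 2.
  by under eq_bigr do rewrite F2; rewrite mulr_suml.
have G_ge2 : (2 <= #|G|)%N by rewrite card_sum (leq_trans m2) // leq_addr.
have := nl_eigenvalue2_le G_ge2 _ F_perp; rewrite volG ltr_wpDr // => /(_ isT).
rewrite coalescence_sum_degree sq1 sq2 coalescence_edge_sum.
rewrite [X in _ <= (_ + X) / 2 -> _]big1 => [|y _]; last first.
  by rewrite big1 // => z _; rewrite !F2 subrr expr0n.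
rewrite addr0; set E := edge_sum _; set E' := edge_sum _.
have -> : E = E'.
  by apply: eq_bigr => x _; apply: eq_bigr => y _; rewrite !F1; ring.
(* Since [f u - c] equals [V1 * f u / (V1 + V2)], the terms [V1 * c ^+ 2] and [V2 * (f u - c) ^+ 2]
   add up to the stated gain in norm. *)
congr (_ * _ <= _); rewrite /c; field.
by rewrite V_neq0.
Qed.

Lemma coalescence_eigenvalue2_le : nl_eigenvalue G 2 <= nl_eigenvalue G1 2 :> R.
Proof.
have [f [D_gt0 f_perp Ef]] :=
  nl_eigenvalue2_attained R m2 (fun x => connected_degree conn1 x m2).
have := le_trans (coalescence_eigenvalue2 f_perp) Ef.
set D := \sum_x _ in D_gt0 Ef *; set t := f u ^+ 2 * _; rewrite mulrDr => lt_lm.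
have t_ge0 : 0 <= t.
  by rewrite mulr_ge0 ?sqr_ge0 // divr_ge0 ?mulr_ge0 ?addr_ge0 ?sumr_ge0.
have mu_ge0 : 0 <= nl_eigenvalue G1 2 :> R.
  rewrite -(pmulr_lge0 _ D_gt0); apply: le_trans Ef.
  rewrite divr_ge0 // sumr_ge0 // => x _.
  by rewrite sumr_ge0 // => y _; rewrite sqr_ge0.
(* Dropping the gain [t] from the left of [lt_lm] needs a nonnegative eigenvalue of the coalescence,
   which the assumed reverse inequality supplies. *)
rewrite leNgt; apply/negP => mu_lt; have lam_ge0 := le_trans mu_ge0 (ltW mu_lt).
have : nl_eigenvalue G 2 * D <= nl_eigenvalue G1 2 * D.
  by apply: le_trans lt_lm; rewrite lerDl mulr_ge0.
by rewrite ler_pM2r // leNgt mu_lt.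
Qed.

Lemma coalescence_eigenvalue2_lt (f1 : {ffun G1 -> R}) :
  connected_graph G2 -> (2 <= #|G2|)%N ->
  harmonic_eigenfunction2 f1 -> f1 u != 0 ->
  nl_eigenvalue G 2 < nl_eigenvalue G1 2 :> R.
Proof.
move=> conn2 n2 [f_neq0 f_perp Rf] fu.
have D_gt0 : 0 < \sum_x (degree x)%:R * f1 x ^+ 2.
  rewrite (bigD1 u) //= ltr_wpDr ?sumr_ge0 // => [x _|].
    by rewrite mulr_ge0 ?sqr_ge0.
  by rewrite mulr_gt0 ?exprn_even_gt0 // ltr0n lt0n connected_degree.
have E_gt0 : 0 < edge_sum (fun x y => (f1 x - f1 y) ^+ 2).
  (* A constant function orthogonal to [De] has value 0, as the volume is positive; this contradicts
     [fu]. *)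
  have [x fx] : exists x, f1 x != f1 u.
    apply/existsP; apply: contraT; rewrite negb_exists => /forallP fE.
    move/eqP: f_perp; under eq_bigr => x _ do rewrite (eqP (negbNE (fE x))).
    by rewrite -mulr_suml mulf_eq0 (negbTE fu) orbF gt_eqF // connected_volume.
  exact: connected_edge_sum_gt0 fx.
have Ef : edge_sum (fun x y => (f1 x - f1 y) ^+ 2) / 2 =
    nl_eigenvalue G1 2 * \sum_x (degree x)%:R * f1 x ^+ 2.
  by rewrite -Rf /rayleigh divfK // gt_eqF.
have := coalescence_eigenvalue2 f_perp; rewrite Ef.
have : 0 < edge_sum (fun x y => (f1 x - f1 y) ^+ 2) / 2 by rewrite divr_gt0.
rewrite Ef pmulr_lgt0 //; set D := \sum_x _ in D_gt0 *; set t := f1 u ^+ 2 * _.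
have t_gt0 : 0 < t.
  by rewrite mulr_gt0 ?exprn_even_gt0 // divr_gt0 ?mulr_gt0 ?addr_gt0 //
    connected_volume.
set l := nl_eigenvalue _ _; set m := nl_eigenvalue _ _ => m_gt0 H.
(* If [l] were at least [m], then [l * (D + t)] would be at least [m * D + m * t], which exceeds
   [m * D] because [m] and [t] are positive. *)
rewrite ltNge; apply/negP => ml; nra.
Qed.

End Glue.

(** A second eigenvalue of [G1] exists only from two vertices on; beyond the end of the spectrum
    [nl_eigenvalue] returns the default 0. Strictness asks for two vertices in [G2], because gluing
    on a single vertex merely reproduces [G1]. *)
Theorem theorem3p3 (R : realType) (G1 G2 : sgraph) (m n : nat)
    (ord1 : #|G1| = m) (ord2 : #|G2| = n)
    (conn1 : connected_graph G1) (conn2 : connected_graph G2)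
    (m_ge2 : (2 <= m)%N)
    (u : G1) (v : G2) :
  (nl_eigenvalue (coalescence u v) 2 <= nl_eigenvalue G1 2 :> R) /\
  ((2 <= n)%N ->
   forall f1 : {ffun G1 -> R},
     harmonic_eigenfunction2 f1 -> f1 u != 0 ->
     nl_eigenvalue (coalescence u v) 2 < nl_eigenvalue G1 2 :> R).
Proof.
subst m n; split; first exact: coalescence_eigenvalue2_le.
by move=> n_ge2 f1; exact: coalescence_eigenvalue2_lt.
Qed.
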